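(* Let $p\in[0,1]$ and let $(x_i)_{i\in\mathbb{Z}}$ be independent and identically distributed $\{0,1\}$-valued random variables with $\Pr(x_i=1)=p$ and $\Pr(x_i=0)=1-p$. For a finite block $\mathbf{a}=a_1\ldots a_k$ of symbols in $\{0,1\}$, let $P_n(\mathbf{a})$ be the probability that $\mathbf{a}$ occurs at a given position after $n$ iterations of rule 156, i.e. $P_n(\mathbf{a})=\Pr\big([F_{156}^n(x)]_{i+l-1}=a_l \text{ for } l=1,\ldots,k\big)$ (which does not depend on $i\in\mathbb{Z}$). Then for every integer $n>1$, \begin{align*} P_n(00)&=\frac{1}{2}\,\frac{p(p-1)(2p^4-4p^3+2p^2+1)}{(1+p)(p-2)}-\frac{1}{2}\,\frac{(p-1)p^{n+2}}{1+p}+\frac{1}{2}\,\frac{(3p-4)(1-p)^{n+2}}{p-2}\\ &\quad+\frac{1}{2}\,\frac{(2p-1)(p-1)(-p)^{n+2}}{1+p}-\frac{1}{2}\,\frac{p(2p-1)(p-1)^{n+2}}{p-2}-\frac{1}{2}\,\frac{p(p-1)(2p-1)(-1)^n}{(1+p)(p-2)},\\ P_n(000)&=(1-p)^{n+3},\\ P_n(010)&=-\frac{1}{2}\,\frac{4p^6-12p^5+12p^4-4p^3+p^2-p+2}{(1+p)(p-2)}+\frac{(p^2-p-1)p^{n+2}}{1+p}+\frac{(1-p)^{n+2}}{p-2}\\ &\quad-\frac{(2p-1)(p-1)(-p)^{n+2}}{1+p}+\frac{p(2p-1)(p-1)^{n+2}}{p-2}-\frac{1}{2}\,\frac{p(p-1)(2p-1)(-1)^n}{(1+p)(p-2)}.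 \end{align*}
   Context: The local function of elementary cellular automaton rule 156 is $f_{156}:\{0,1\}^3\to\{0,1\}$, equal to $1$ exactly on $010,011,100,111$ and $0$ otherwise. The global function $F_{156}:\{0,1\}^{\mathbb{Z}}\to\{0,1\}^{\mathbb{Z}}$ is $[F_{156}(x)]_i=f_{156}(x_{i-1},x_i,x_{i+1})$, and $F_{156}^n$ is its $n$-fold composition. *)

(* Defs.v *)
From HB Require Import structures.
From mathcomp Require Import all_boot all_order all_algebra.
From mathcomp Require Import finmap.
From mathcomp Require Import all_classical all_reals all_analysis.

Set Implicit Arguments.
Unset Strict Implicit.
Unset Printing Implicit Defensive.

Import Order.TTheory GRing.Theory Num.Theory.

Local Open Scope classical_set_scope.
Local Open Scope ring_scope.

(** The symbols 0 and 1 are [false] and [true]; bi-infinite configurations are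
    functions [int -> bool] and blocks are [seq bool]. *)

Definition f156 (a b c : bool) : bool :=
  (a, b, c) \in [:: (false, true, false); (false, true, true);
                    (true, false, false); (true, true, true)].

Definition F156 (x : int -> bool) : int -> bool :=
  fun i => f156 (x (i - 1)) (x i) (x (i + 1)).

(** Mutual independence of a family of random variables: the product rule over
    every finite set of indices and every choice of measurable events. *)
Definition mutually_independent d d' (T : measurableType d)
    (T' : measurableType d') (R : realType) (P : probability T R)
    (I : choiceType) (X : I -> {RV P >-> T'}) : Prop :=
  forall (J : {fset I}) (A : I -> set T'),
    (forall i, i \in J -> measurable (A i)) ->
    P (\bigcap_(i in [set` J]) (X i @^-1` A i)) =
    (\prod_(i <- enum_fset J) P (X i @^-1` A i))%E.

(** [a] occurs in the configuration [x] with its first symbol at position [i]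
    (the symbols of [a] being numbered from 0). *)
Definition occurs_at (x : int -> bool) (i : int) (a : seq bool) : Prop :=
  forall l : nat, (l < size a)%N -> x (i + l%:Z) = nth false a l.

Definition block_prob d (T : measurableType d) (R : realType)
    (P : probability T R) (X : int -> {RV P >-> bool})
    (n : nat) (i : int) (a : seq bool) : \bar R :=
  P [set w | occurs_at (iter n F156 (fun j => X j w)) i a].

(* Main.v *)
Require Import Defs.
From HB Require Import structures.
From mathcomp Require Import all_boot all_order all_algebra.
From mathcomp Require Import finmap.
From mathcomp Require Import all_classical all_reals all_analysis.
From mathcomp Require Import ring lra.

Import Order.TTheory GRing.Theory Num.Theory.

Local Open Scope classical_set_scope.
Local Open Scope ring_scope.

(** The new value is x_i' = x_i + x_{i-1} (1 - x_{i+1}) mod 2, so an occurrence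
    of 01 never disappears, and it is a wall: the word strictly between two
    consecutive walls evolves on its own.  Such a word has the form 1^a 0^b; a
    border 1100 creates a new wall, and after finitely many steps every word
    is empty or alternates between the one-letter words 0 and 1.

    Hence, for k >= 3, the block c10^k is present at time n + 1 exactly when
    (1-c)10^{k+1} was present one cell to the left at time n, and likewise for
    1^k0c; these probabilities are explicit.  Counting preimages gives linear
    recurrences that express P_n(010) and P_n(00) through them and through the
    probabilities of 01001 and 01101, the two phases of an oscillating word,
    which satisfy
      P_{n+1}(01001) = P_n(01101) + P_n(110001),
      P_{n+1}(01101) = P_n(01001) + P_n(011100). *)

(** * Finite words, windows of a configuration, and images of blocks *)

Fixpoint words (m : nat) : seq (seq bool) :=
  if m is m'.+1 then map (cons false) (words m') ++ map (cons true) (words m')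
  else [:: [::]].

Lemma mem_words (m : nat) (w : seq bool) : (w \in words m) = (size w == m).
Proof.
elim: m w => [|m IHm] [|b w] //=.
  by rewrite mem_cat; apply/negbTE; rewrite negb_or; apply/andP; split;
     apply/negP => /mapP [].
rewrite mem_cat eqSS -IHm.
have inj c : injective (cons c : seq bool -> _) by move=> x y [].
have neq c : (~~ c :: w \in [seq c :: u | u <- words m]) = false.
  by apply/negP => /mapP [u _ []]; case: c.
case: b; first by rewrite (neq false) (mem_map (inj true)).
by rewrite (mem_map (inj false)) (neq true) orbF.
Qed.

Lemma uniq_words (m : nat) : uniq (words m).
Proof.
elim: m => //= m IHm.
rewrite cat_uniq !map_inj_uniq ?IHm /= ?andbT; try by move=> x y [].
by apply/hasPn => _ /mapP [u _ ->]; apply/negP => /mapP [].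
Qed.

Fixpoint block_image (w : seq bool) : seq bool :=
  if w is a :: ((b :: c :: _) as w') then f156 a b c :: block_image w'
  else [::].

Definition window (x : int -> bool) (i : int) (m : nat) : seq bool :=
  [seq x (i + l%:Z) | l <- iota 0 m].

Lemma size_window x i m : size (window x i m) = m.
Proof. by rewrite size_map size_iota. Qed.

Lemma window_cons x i m : window x i m.+1 = x i :: window x (i + 1) m.
Proof.
rewrite /window /= addr0; congr cons.
rewrite -[1%N]/(1 + 0)%N iotaDl -map_comp; apply: eq_map => l /=.
by rewrite PoszD addrA.
Qed.

Lemma occurs_atE x i a : occurs_at x i a <-> window x i (size a) = a.
Proof.
elim: a i => [|b a IHa] i; first by split.
rewrite window_cons; split=> [H|[H1 H2] [|l] lt_l] /=.
- congr cons; first by have := H 0%N isT; rewrite addr0.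
  by apply/IHa => l lt_l; rewrite -addrA -PoszD add1n (H l.+1).
- by rewrite addr0.
- by move/IHa: H2 => <- //; rewrite -addrA -PoszD add1n.
Qed.

Lemma window_F156 x i m :
  window (F156 x) i m = block_image (window x (i - 1) m.+2).
Proof.
elim: m i => [|m IHm] i; first by [].
rewrite window_cons IHm !(window_cons x) /= /F156.
by rewrite !(subrK, addrK).
Qed.

Lemma window_sub x i m l k : (l + k <= m)%N ->
  window x (i + l%:Z) k = take k (drop l (window x i m)).
Proof.
elim: l i m => [|l IHl] i m.
  rewrite add0n addr0 drop0.
  elim: k i m => [|k IHk] i [|m] //; rewrite ?take0 // ltnS => le_km.
  by rewrite !window_cons /= (IHk _ m).
case: m => // m; rewrite addSn ltnS => le_m.
by rewrite -add1n PoszD addrA (IHl _ m) // window_cons.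
Qed.

(** A pair is an offset together with a block. The test is boolean so that identities between
    numbers of occurrences can be checked by evaluation over [words m]. *)
Definition occurs_in (w : seq bool) (lb : nat * seq bool) : bool :=
  take (size lb.2) (drop lb.1 w) == lb.2.


(** * Preimages of long runs *)

Lemma block_image_cons a b c w :
  block_image [:: a, b, c & w] = f156 a b c :: block_image [:: b, c & w].
Proof. by []. Qed.

(** Since [f156 a 0 0 = a], zeros propagate to the left, and since [f156 0 0 z = 0], the last cell
    [z] stays free. Three zeros are the least that works: 1101 also maps to 00. *)
Lemma block_image_zeros k u z : size u = k.+4 ->
  (block_image (rcons u z) == nseq k.+3 false) = (u == nseq k.+4 false).
Proof.
elim: k u => [|k IHk] [|a u] //= [sz_u].
  by case: u sz_u => [|b [|c [|e []]]] // _; case: a b c e z => [] [] [] [] [].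
case: u sz_u => [|b [|c u]] //= sz_u.
have := IHk [:: b, c & u] sz_u; rewrite /= !eqseq_cons => ->.
by case: a b c => [] [] []; rewrite /= ?andbF.
Qed.

(** The run of zeros is forced by [block_image_zeros]; then [f156 b 0 0 = b] forces the symbol 1
    before it, and [f156 a 1 0 = ~~ a] flips the symbol before that. *)
Lemma block_image_zeros_tail k c u z : size u = k.+4.+2 ->
  (block_image (rcons u z) == [:: c, true & nseq k.+3 false]) =
  (u == [:: ~~ c, true & nseq k.+4 false]).
Proof.
case: u => [|a [|b u]] // [sz_u].
have := block_image_zeros k u z sz_u.
case: u sz_u => [|e [|f u]] // sz_u.
rewrite !rcons_cons !block_image_cons !eqseq_cons => ->.
by case: a b c e f {sz_u} => [] [] [] [] []; rewrite /= ?andbF.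
Qed.

(** Mirror image of [block_image_zeros_tail]: rule 156 commutes with reflection combined with
    exchange of 0 and 1. The free cell [z] is therefore now the first one. *)
Lemma block_image_ones k c u z : size u = k.+4.+2 ->
  (block_image (z :: u) == nseq k.+3 true ++ [:: false; c]) =
  (u == nseq k.+4 true ++ [:: false; ~~ c]).
Proof.
elim: k u z => [|k IHk] [|a u] z // [sz_u].
  case: u sz_u => [|b [|e [|f [|g [|h []]]]]] // _.
  by case: a b c e f => [] [] [] [] []; case: g h z => [] [] [].
have := IHk u a sz_u; case: u sz_u => [|b u] // sz_u.
rewrite (block_image_cons z) /= !eqseq_cons => ->.
by case: a b z {sz_u} => [] [] []; rewrite /= ?andbF.
Qed.

Lemma size_block_image w : size (block_image w) = (size w).-2.
Proof.
elim: w => [|a [|b [|c w]] IHw] //.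
by rewrite block_image_cons -[LHS]/((size (block_image _)).+1) IHw.
Qed.

Lemma occurs_inE w l b : occurs_in w (l, b) = (take (size b) (drop l w) == b).
Proof. by []. Qed.

Lemma half_sum_diff (F : numFieldType) (x y s t : F) :
  x + y = s -> x - y = t -> x = (s + t) / 2 /\ y = (s - t) / 2.
Proof. by move=> <- <-; split; field. Qed.

(** * Block probabilities as sums over windows *)

Section Probabilities.

Variables (d : measure_display) (T : measurableType d) (R : realType).
Variables (P : probability T R) (X : int -> {RV P >-> bool}).

Definition conf (n : nat) (w : T) : int -> bool := iter n F156 (fun j => X j w).

Lemma measurable_conf n j b : measurable [set w | conf n w j = b].
Proof.
elim: n j b => [|n IHn] j b.
  exact: (@measurable_funPTI _ _ _ _ (X j) [set b]).
have -> : [set w | conf n.+1 w j = b] =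
    \bigcup_(t in [set t : bool * bool * bool | f156 t.1.1 t.1.2 t.2 = b])
      ([set w | conf n w (j - 1) = t.1.1] `&` [set w | conf n w j = t.1.2]
       `&` [set w | conf n w (j + 1) = t.2]).
  apply/seteqP; split => w /=.
    by move=> <-; exists (conf n w (j - 1), conf n w j, conf n w (j + 1)).
  by case=> [[[a1 a2] a3]] /= <- [[<- <-] <-].
apply: fin_bigcup_measurable => // t _.
by apply: measurableI => //; apply: measurableI.
Qed.

Lemma measurable_occurs n i a : measurable [set w | occurs_at (conf n w) i a].
Proof.
elim: a i => [|b a IHa] i.
  by rewrite (_ : mkset _ = setT) //; apply/seteqP; split.
rewrite (_ : mkset _ = [set w | conf n w i = b] `&`
                       [set w | occurs_at (conf n w) (i + 1) a]).
  by apply: measurableI => //; exact: measurable_conf.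
apply/seteqP; split => w /=.
  by move/occurs_atE; rewrite window_cons => -[? H]; split=> //; apply/occurs_atE.
by case=> H /occurs_atE H2; apply/occurs_atE; rewrite window_cons H H2.
Qed.

Lemma probability_window n i m (S : pred (seq bool)) :
  P [set w | S (window (conf n w) i m)] =
  (\sum_(v <- words m | S v) block_prob X n i v)%E.
Proof.
rewrite -big_filter.
have -> : [set w | S (window (conf n w) i m)] =
  \big[setU/set0]_(v <- [seq v <- words m | S v])
     [set w | occurs_at (conf n w) i v].
  rewrite -bigcup_seq; apply/seteqP; split => w /=.
    move=> Sw; exists (window (conf n w) i m) => /=.
      by rewrite mem_filter Sw mem_words size_window eqxx.
    by apply/occurs_atE; rewrite size_window.
  case=> v /=; rewrite mem_filter mem_words => /andP[Sv /eqP <-].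
  by move/occurs_atE ->.
have := uniq_words m; move/(filter_uniq S).
(* Distinct words of the same length cannot occur at the same position, so the events in the union
   are disjoint. *)
have: all (fun v : seq bool => size v == m) [seq v <- words m | S v].
  by apply/allP => v; rewrite mem_filter mem_words => /andP[].
elim: [seq v <- words m | S v] => [|v s IHs].
  by rewrite !big_nil measure0.
move=> /= /andP[/eqP sz_v sz_s] /andP[v_s uniq_s].
rewrite !big_cons measureU.
- by congr (_ + _)%E; exact: IHs.
- exact: measurable_occurs.
- by apply: bigsetU_measurable => ? _; exact: measurable_occurs.
- rewrite -bigcup_seq; apply/seteqP; split => // w /= [/occurs_atE Hv].
  case=> u /= u_s /occurs_atE Hu.
  move/allP/(_ _ u_s)/eqP: sz_s => sz_u.
  by move: v_s; rewrite -Hv sz_v -sz_u Hu u_s.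
Qed.

Lemma block_prob_split n i m l b : (l + size b <= m)%N ->
  block_prob X n (i + l%:Z) b =
  (\sum_(v <- words m | occurs_in v (l, b)) block_prob X n i v)%E.
Proof.
move=> le_m; rewrite -(probability_window _ _ _ (fun v => occurs_in v (l, b))).
congr (P _); apply/seteqP; split => w /=; rewrite /occurs_in /=.
  by move/occurs_atE; rewrite (window_sub _ _ m) // => ->.
by move/eqP => H; apply/occurs_atE; rewrite (window_sub _ _ m).
Qed.

Lemma block_prob_step n i m l b : (l + size b <= m)%N ->
  block_prob X n.+1 (i + l%:Z) b =
  (\sum_(v <- words m.+2 | occurs_in (block_image v) (l, b))
     block_prob X n (i - 1) v)%E.
Proof.
move=> le_m; rewrite -(probability_window _ _ _
  (fun v => occurs_in (block_image v) (l, b))).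
congr (P _); apply/seteqP; split => w; rewrite /mkset /occurs_in -window_F156 /=.
  by move/occurs_atE; rewrite (window_sub _ _ m) // => ->.
by move/eqP => H; apply/occurs_atE; rewrite (window_sub _ _ m).
Qed.

(** * The independent initial law and stationarity *)

Variable p : R.
Hypothesis X_indep : mutually_independent X.
Hypothesis X_true : forall i : int, P (X i @^-1` [set true]) = p%:E.
Hypothesis X_false : forall i : int, P (X i @^-1` [set false]) = (1 - p)%:E.

Definition bit_prob (b : bool) : R := if b then p else 1 - p.

Lemma block_prob0 i a :
  block_prob X 0 i a = (\prod_(b <- a) bit_prob b)%:E.
Proof.
pose J := seq_fset tt [seq i + l%:Z | l <- iota 0 (size a)].
pose A j := [set nth false a `|j - i|%N].
have AE l : A (i + l%:Z) = [set nth false a l].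
  by rewrite /A addrC addKr.
have JP j : reflect (exists2 l, (l < size a)%N & j = i + l%:Z) (j \in J).
  rewrite seq_fsetE; apply: (iffP mapP) => -[l]; rewrite ?mem_iota => lt_l ->.
    by exists l.
  by exists l; rewrite ?mem_iota.
rewrite /block_prob.
have -> : [set w | occurs_at (iter 0 F156 (fun j => X j w)) i a] =
   \bigcap_(j in [set` J]) (X j @^-1` A j).
  apply/seteqP; split => w /= H.
    by move=> j /= /JP[l lt_l ->]; rewrite AE /=; exact: H.
  by move=> l lt_l; have := H (i + l%:Z); rewrite AE; apply; apply/JP; exists l.
rewrite X_indep; last by [].
rewrite (perm_big [seq i + l%:Z | l <- iota 0 (size a)]) /=; last first.
  apply: perm_trans (seq_fset_perm tt _) _.
  by rewrite undup_id // map_inj_uniq ?iota_uniq // => x y /addrI [].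
rewrite -prodEFin -[in RHS](mkseq_nth false a) !big_map.
apply: eq_bigr => l _; rewrite AE.
by case: nth; rewrite ?X_true ?X_false.
Qed.

(** At time 0 the product formula does not mention the position; a step of the rule sums over the
    same preimage words at every position. *)
Lemma block_prob_shift n i j a : block_prob X n i a = block_prob X n j a.
Proof.
elim: n i j a => [|n IHn] i j a; first by rewrite !block_prob0.
rewrite -[i]addr0 -[j]addr0 !(block_prob_step _ _ (size a) 0) //.
by apply: eq_bigr => v _; exact: IHn.
Qed.

Definition prob (n : nat) (a : seq bool) : R := fine (block_prob X n 0 a).

Lemma block_probE n i a : block_prob X n i a = (prob n a)%:E.
Proof.
rewrite /prob (block_prob_shift n i 0) fineK // fin_num_measure //.
exact: measurable_occurs.
Qed.

Lemma prob0 a : prob 0 a = \prod_(b <- a) bit_prob b.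
Proof. by rewrite /prob block_prob0. Qed.

Lemma prob_split n m l b : (l + size b <= m)%N ->
  prob n b = \sum_(v <- words m | occurs_in v (l, b)) prob n v.
Proof.
move=> le_m; apply: EFin_inj; rewrite -(block_probE n (0 + l%:Z)).
rewrite (block_prob_split _ _ m) // -sumEFin.
by apply: eq_bigr => v _; rewrite block_probE.
Qed.

Lemma prob_step n m l b : (l + size b <= m)%N ->
  prob n.+1 b =
  \sum_(v <- words m.+2 | occurs_in (block_image v) (l, b)) prob n v.
Proof.
move=> le_m; apply: EFin_inj; rewrite -(block_probE n.+1 (0 + l%:Z)).
rewrite (block_prob_step _ _ m) // -sumEFin.
by apply: eq_bigr => v _; rewrite block_probE.
Qed.

(** * Linear relations from counting occurrences *)

Definition fits (m : nat) (s : seq (nat * seq bool)) :=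
  all (fun lb => lb.1 + size lb.2 <= m)%N s.

Lemma prob_count n m (f : seq bool -> seq bool) s :
  \sum_(lb <- s) \sum_(v <- words m | occurs_in (f v) lb) prob n v =
  \sum_(v <- words m) prob n v *+ count (occurs_in (f v)) s.
Proof.
under eq_bigr do rewrite big_mkcond.
rewrite exchange_big; apply: eq_bigr => v _.
by rewrite -big_mkcond /= big_const_seq iter_addr_0.
Qed.

(* [s1], [s0] and [s] list blocks with their offsets in a window of [m] cells
   at time [n.+1], resp. of [m.+2] cells at time [n].  If every window at time
   [n] sees as many occurrences on both sides, the probabilities add up. *)
Lemma prob_relation (m : nat) (s1 s0 s : seq (nat * seq bool)) n :
  [&& fits m s1, fits m.+2 s0, fits m.+2 s
    & all (fun v => count (occurs_in (block_image v)) s1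
                    + count (occurs_in v) s0 == count (occurs_in v) s)%N
          (words m.+2)] ->
  \sum_(lb <- s1) prob n.+1 lb.2 + \sum_(lb <- s0) prob n lb.2 =
  \sum_(lb <- s) prob n lb.2.
Proof.
case/and4P => /allP fit1 /allP fit0 /allP fit /allP cnt.
have split_sum r : {in r, forall lb, (lb.1 + size lb.2 <= m.+2)%N} ->
    \sum_(lb <- r) prob n lb.2 =
    \sum_(v <- words m.+2) prob n v *+ count (occurs_in v) r.
  move=> fit_r; rewrite -(prob_count _ _ id) !big_seq.
  by apply: eq_bigr => -[l b] lb_r; rewrite (prob_split n m.+2 l) // (fit_r (l, b)).
rewrite !split_sum //.
have -> : \sum_(lb <- s1) prob n.+1 lb.2 =
    \sum_(v <- words m.+2) prob n v *+ count (occurs_in (block_image v)) s1.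
  rewrite -prob_count !big_seq; apply: eq_bigr => -[l b] lb_s.
  by rewrite (prob_step n m l) // (fit1 (l, b)).
rewrite -big_split /= !big_seq; apply: eq_bigr => v v_m.
by rewrite -mulrnDr (eqP (cnt v v_m)).
Qed.

(** Covers blocks whose preimages are exactly the extensions of a single block [b] by free cells,
    [l] of them on its left. *)
Lemma prob_step1 n l a b : (l + size b <= (size a).+2)%N ->
  (forall v, size v = (size a).+2 -> (block_image v == a) = occurs_in v (l, b)) ->
  prob n.+1 a = prob n b.
Proof.
move=> le_b Hab; rewrite (prob_step _ (size a) 0) // (prob_split _ _ _ _ le_b).
rewrite big_seq_cond [RHS]big_seq_cond; apply: eq_bigl => v.
rewrite mem_words; case: eqP => //= sz_v; rewrite -Hab // /occurs_in /= drop0.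
by rewrite take_oversize // size_block_image sz_v.
Qed.

(** * Explicit probabilities of long runs *)

Lemma prob_zeros n k : prob n (nseq k.+3 false) = (1 - p) ^+ (n + k.+3).
Proof.
elim: n k => [|n IHn] k; first by rewrite prob0 big_nseq iter_mulr_1.
rewrite addSnnS -IHn; apply: (prob_step1 _ 0); rewrite ?size_nseq //.
move=> v; case/lastP: v => // u z.
rewrite size_rcons => -[sz_u]; rewrite block_image_zeros // occurs_inE drop0.
by rewrite size_nseq -cats1 take_size_cat.
Qed.

(** Going back one step lengthens the run by one and flips [c]; at time 0 the flipped symbol is
    [c (+) odd n]. *)
Lemma prob_01zeros n k c :
  prob n [:: c, true & nseq k.+3 false] =
  bit_prob (c (+) odd n) * (p * (1 - p) ^+ (n + k.+3)).
Proof.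
elim: n k c => [|n IHn] k c.
  by rewrite prob0 2!big_cons big_nseq iter_mulr_1 addbF.
rewrite addSnnS [odd n.+1]/= addbN -addNb -IHn; apply: (prob_step1 _ 0) => /=.
  by rewrite !size_nseq.
rewrite !size_nseq => v; case/lastP: v => // u z.
rewrite size_rcons => -[sz_u]; rewrite block_image_zeros_tail // occurs_inE drop0.
by rewrite -cats1 [size (_ :: _)]/= size_nseq take_size_cat.
Qed.

Lemma prob_ones01 n k c :
  prob n (nseq k.+3 true ++ [:: false; c]) =
  bit_prob (c (+) odd n) * ((1 - p) * p ^+ (n + k.+3)).
Proof.
elim: n k c => [|n IHn] k c.
  rewrite prob0 big_cat big_nseq iter_mulr_1 !big_cons big_nil /= addbF mulr1.
  by rewrite mulrC mulrAC mulrC.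
rewrite addSnnS [odd n.+1]/= addbN -addNb -IHn; apply: (prob_step1 _ 1).
  by rewrite /= !size_cat !size_nseq.
rewrite !size_cat size_nseq addn2 => -[|z u] // [sz_u].
rewrite block_image_ones // occurs_inE drop1.
by rewrite take_oversize // size_cat size_nseq addn2 sz_u.
Qed.

(** * Recurrences for short blocks *)

(** The block 110001 enters as 11000 minus 110000, since those two have explicit probabilities. The
    relations below use the same device to avoid subtraction when counting. *)
Lemma prob_01001_step n :
  prob n.+1 [:: false; true; false; false; true] + prob n [:: true; true; false; false; false; false]
  = prob n [:: false; true; true; false; true] + prob n [:: true; true; false; false; false].
Proof.
(* [isT] proves the side condition by evaluating the counts on all 128 windows of 7 cells. *)
have := prob_relation 5 [:: (0, [:: false; true; false; false; true])]%N
  [:: (0, [:: true; true; false; false; false; false])]%N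
  [:: (1, [:: false; true; true; false; true]); (0, [:: true; true; false; false; false])]%N n isT.
by rewrite !big_cons !big_nil !addr0 ?add0r ?addrA.
Qed.

Lemma prob_01101_step n :
  prob n.+1 [:: false; true; true; false; true] + prob n [:: true; true; true; true; false; false]
  = prob n [:: false; true; false; false; true] + prob n [:: true; true; true; false; false].
Proof.
have := prob_relation 5 [:: (0, [:: false; true; true; false; true])]%N
  [:: (1, [:: true; true; true; true; false; false])]%N
  [:: (1, [:: false; true; false; false; true]); (2, [:: true; true; true; false; false])]%N n isT.
by rewrite !big_cons !big_nil !addr0 ?add0r ?addrA.
Qed.

(** Up to free cells, the preimages of 010 are 0101, 0110 and 1100. Here 0101 is 010 minus 01001 and
    01000, while 0110 splits into 01101 and 01100. *)
Lemma prob_010_step n :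
  prob n.+1 [:: false; true; false] + prob n [:: false; true; false; false; true] + prob n [:: false; true; false; false; false]
  = prob n [:: false; true; false] + prob n [:: false; true; true; false; true] + prob n [:: false; true; true; false; false] + prob n [:: true; true; false; false].
Proof.
have := prob_relation 4 [:: (0, [:: false; true; false])]%N
  [:: (1, [:: false; true; false; false; true]); (1, [:: false; true; false; false; false])]%N
  [:: (1, [:: false; true; false]); (1, [:: false; true; true; false; true]); (1, [:: false; true; true; false; false]); (0, [:: true; true; false; false])]%N n isT.
by rewrite !big_cons !big_nil !addr0 ?add0r ?addrA.
Qed.

Lemma prob_01100_step n :
  prob n.+1 [:: false; true; true; false; false] + prob n [:: true; true; true; true; false; true]
  = prob n [:: false; true; false; false; false] + prob n [:: true; true; true; false; true].
Proof.
have := prob_relation 5 [:: (0, [:: false; true; true; false; false])]%N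
  [:: (1, [:: true; true; true; true; false; true])]%N
  [:: (1, [:: false; true; false; false; false]); (2, [:: true; true; true; false; true])]%N n isT.
by rewrite !big_cons !big_nil !addr0 ?add0r ?addrA.
Qed.

Lemma prob_1100_step n :
  prob n.+1 [:: true; true; false; false]
  = prob n [:: false; true; false; false; false] + prob n [:: true; true; true; false; true].
Proof.
have := prob_relation 4 [:: (0, [:: true; true; false; false])]%N
  [::]
  [:: (0, [:: false; true; false; false; false]); (1, [:: true; true; true; false; true])]%N n isT.
by rewrite !big_cons !big_nil !addr0 ?add0r ?addrA.
Qed.

Lemma prob_11001_step n :
  prob n.+1 [:: true; true; false; false; true] + prob n [:: false; true; false; false; false; false]
  = prob n [:: true; true; true; false; true] + prob n [:: false; true; false; false; false].
Proof.
have := prob_relation 5 [:: (0, [:: true; true; false; false; true])]%N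
  [:: (0, [:: false; true; false; false; false; false])]%N
  [:: (1, [:: true; true; true; false; true]); (0, [:: false; true; false; false; false])]%N n isT.
by rewrite !big_cons !big_nil !addr0 ?add0r ?addrA.
Qed.

(** Inclusion-exclusion at a single time: either 00 has a neighbouring 0 on the left or on the
    right, or it sits inside 1001, which is then split by the symbol to its left. *)
Lemma prob_00_split n :
  prob n [:: false; false] + prob n [:: false; false; false; false]
  = prob n [:: false; false; false] + prob n [:: false; false; false] + prob n [:: false; true; false; false; true] + prob n [:: true; true; false; false; true].
Proof.
have := prob_relation 3 [::]
  [:: (2, [:: false; false]); (1, [:: false; false; false; false])]%N
  [:: (1, [:: false; false; false]); (2, [:: false; false; false]); (0, [:: false; true; false; false; true]); (0, [:: true; true; false; false; true])]%N n isT.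
by rewrite !big_cons !big_nil !addr0 ?add0r ?addrA.
Qed.

(** * Solving the recurrences *)

Lemma bit_prob_odd n b :
  bit_prob (b (+) odd n) = (1 + (-1) ^+ b * (-1) ^+ n * (1 - 2 * p)) / 2.
Proof.
rewrite -[(-1) ^+ n]signr_odd -signr_addb /bit_prob.
by case: addb; rewrite /= ?expr0 ?expr1; field.
Qed.

Hypothesis p01 : 0 <= p <= 1.

(* The sum of the recurrences for 01001 and 01101 has eigenvalue 1, their
   difference eigenvalue -1; [F] and [G] are the shared transient terms. *)
Let F n : R := - (p * (1 - p) ^+ 3 * (1 - p) ^+ n + (1 - p) * p ^+ 3 * p ^+ n) / 2.
Let G n : R := (p ^+ 2 * (1 - p) ^+ 3 * (1 - p) ^+ n / (2 - p)
  - (1 - p) ^+ 2 * p ^+ 3 * p ^+ n / (1 + p)) / 2.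

Lemma prob_01001_01101 n :
  prob n [:: false; true; false; false; true]
    + prob n [:: false; true; true; false; true]
  = p ^+ 2 * (1 - p) ^+ 2 - F 0 - (1 - 2 * p) * G 0
    + F n + (1 - 2 * p) * (-1) ^+ n * G n /\
  prob n [:: false; true; false; false; true]
    - prob n [:: false; true; true; false; true]
  = (p ^+ 2 * (1 - p) ^+ 2 * (1 - 2 * p) - G 0 - (1 - 2 * p) * F 0) * (-1) ^+ n
    + G n + (1 - 2 * p) * (-1) ^+ n * F n.
Proof.
have [p_ge0 p_le1] := andP p01.
have p1 : 1 + p != 0 by rewrite gt_eqF //; lra.
have p2 : 2 - p != 0 by rewrite gt_eqF //; lra.
elim: n => [|n [IHs IHd]].
  rewrite !prob0 !big_cons !big_nil /bit_prob /F /G !expr0.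
  by split; field; apply/andP.
have := prob_01001_step n; have := prob_01101_step n.
rewrite (prob_01zeros n 0 true) (prob_01zeros n 1 true).
rewrite (prob_ones01 n 0 false) (prob_ones01 n 1 false).
rewrite !bit_prob_odd !exprD [(-1) ^+ true]/= [(-1) ^+ false]/=.
have [-> ->] := half_sum_diff _ _ _ _ _ IHs IHd.
move=> /(canRL (addrK _)) -> /(canRL (addrK _)) ->; rewrite /F /G !exprS !expr0.
(* With the powers as independent unknowns, what remains is an identity of rational functions. *)
move: (p ^+ n) ((1 - p) ^+ n) ((-1) ^+ n : R) => a b c.
by split; field; apply/andP.
Qed.

Lemma prob_010 n : (0 < n)%N ->
  prob n [:: false; true; false] =
        - (1 / 2 * ((4 * p ^+ 6 - 12 * p ^+ 5 + 12 * p ^+ 4 - 4 * p ^+ 3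
                      + p ^+ 2 - p + 2) / ((1 + p) * (p - 2))))
         + (p ^+ 2 - p - 1) * p ^+ (n + 2) / (1 + p)
         + (1 - p) ^+ (n + 2) / (p - 2)
         - (2 * p - 1) * (p - 1) * (- p) ^+ (n + 2) / (1 + p)
         + p * (2 * p - 1) * (p - 1) ^+ (n + 2) / (p - 2)
         - 1 / 2 * (p * (p - 1) * (2 * p - 1) * (- 1) ^+ n
                    / ((1 + p) * (p - 2))).
Proof.
have [p_ge0 p_le1] := andP p01.
have p1 : 1 + p != 0 by rewrite gt_eqF //; lra.
have p2 : p - 2 != 0 by rewrite lt_eqF //; lra.
have p2' : 2 - p != 0 by rewrite gt_eqF //; lra.
(* The induction starts at time 1: the explicit values of 1100 and 01100 come from the preceding
   time, and the formula fails at time 0 (for p = 1/2 it gives 0 instead of 1/8). *)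
case: n => // n _; elim: n => [|n IHn].
  have := prob_010_step 0.
  rewrite !prob0 !big_cons !big_nil /bit_prob => /(canRL (addrK _)).
  move=> /(canRL (addrK _)) ->; rewrite !exprS !expr0.
  by field; apply/andP.
have := prob_010_step n.+1.
have /(canRL (addrK _)) -> := prob_01100_step n.
rewrite prob_1100_step IHn.
have [_] := prob_01001_01101 n.+1; move/(canRL (subrK _)) ->.
rewrite !(prob_01zeros _ 0 false).
rewrite (prob_ones01 n 0 true) (prob_ones01 n 1 true).
rewrite !bit_prob_odd => /(canRL (addrK _))/(canRL (addrK _)) ->.
rewrite [(-1) ^+ false]/= /F /G.
rewrite !(exprNn p) -[p - 1]opprB !(exprNn (1 - p)) !exprD !exprS !expr0.
move: (p ^+ n) ((1 - p) ^+ n) ((-1) ^+ n : R) => a b c.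
move: (prob n.+1 _) => y.
by field; rewrite ?p1 ?p2 ?p2'.
Qed.

Lemma prob_00 n : (0 < n)%N ->
  prob n [:: false; false] =
        1 / 2 * (p * (p - 1) * (2 * p ^+ 4 - 4 * p ^+ 3 + 2 * p ^+ 2 + 1)
                  / ((1 + p) * (p - 2)))
         - 1 / 2 * ((p - 1) * p ^+ (n + 2) / (1 + p))
         + 1 / 2 * ((3 * p - 4) * (1 - p) ^+ (n + 2) / (p - 2))
         + 1 / 2 * ((2 * p - 1) * (p - 1) * (- p) ^+ (n + 2) / (1 + p))
         - 1 / 2 * (p * (2 * p - 1) * (p - 1) ^+ (n + 2) / (p - 2))
         - 1 / 2 * (p * (p - 1) * (2 * p - 1) * (- 1) ^+ n
                    / ((1 + p) * (p - 2))).
Proof.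
have [p_ge0 p_le1] := andP p01.
have p1 : 1 + p != 0 by rewrite gt_eqF //; lra.
have p2 : p - 2 != 0 by rewrite lt_eqF //; lra.
have p2' : 2 - p != 0 by rewrite gt_eqF //; lra.
case: n => // n _.
have := prob_00_split n.+1.
have /(canRL (addrK _)) -> := prob_11001_step n.
have [sumE diffE] := prob_01001_01101 n.+1.
have [-> _] := half_sum_diff _ _ _ _ _ sumE diffE.
rewrite (prob_zeros n.+1 0) (prob_zeros n.+1 1).
rewrite (prob_01zeros n 0 false) (prob_01zeros n 1 false) (prob_ones01 n 0 true).
rewrite !bit_prob_odd => /(canRL (addrK _)) ->.
rewrite [(-1) ^+ false]/= /F /G.
rewrite !(exprNn p) -[p - 1]opprB !(exprNn (1 - p)) !exprD !exprS !expr0.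
move: (p ^+ n) ((1 - p) ^+ n) ((-1) ^+ n : R) => a b c.
by field; rewrite ?p1 ?p2 ?p2'.
Qed.

End Probabilities.

Theorem mainTheorem3 (d : measure_display) (T : measurableType d)
    (R : realType) (P : probability T R) (p : R)
    (X : int -> {RV P >-> bool})
    (hp : 0 <= p <= 1)
    (X_indep : mutually_independent X)
    (X_true : forall i : int, P (X i @^-1` [set true]) = p%:E)
    (X_false : forall i : int, P (X i @^-1` [set false]) = (1 - p)%:E)
    (n : nat) (hn : (1 < n)%N) (i : int) :
  [/\ block_prob X n i [:: false; false] =
        (1 / 2 * (p * (p - 1) * (2 * p ^+ 4 - 4 * p ^+ 3 + 2 * p ^+ 2 + 1)
                  / ((1 + p) * (p - 2)))
         - 1 / 2 * ((p - 1) * p ^+ (n + 2) / (1 + p))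
         + 1 / 2 * ((3 * p - 4) * (1 - p) ^+ (n + 2) / (p - 2))
         + 1 / 2 * ((2 * p - 1) * (p - 1) * (- p) ^+ (n + 2) / (1 + p))
         - 1 / 2 * (p * (2 * p - 1) * (p - 1) ^+ (n + 2) / (p - 2))
         - 1 / 2 * (p * (p - 1) * (2 * p - 1) * (- 1) ^+ n
                    / ((1 + p) * (p - 2))))%:E,
      block_prob X n i [:: false; false; false] = ((1 - p) ^+ (n + 3))%:E
    & block_prob X n i [:: false; true; false] =
        (- (1 / 2 * ((4 * p ^+ 6 - 12 * p ^+ 5 + 12 * p ^+ 4 - 4 * p ^+ 3
                      + p ^+ 2 - p + 2) / ((1 + p) * (p - 2))))
         + (p ^+ 2 - p - 1) * p ^+ (n + 2) / (1 + p)
         + (1 - p) ^+ (n + 2) / (p - 2)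
         - (2 * p - 1) * (p - 1) * (- p) ^+ (n + 2) / (1 + p)
         + p * (2 * p - 1) * (p - 1) ^+ (n + 2) / (p - 2)
         - 1 / 2 * (p * (p - 1) * (2 * p - 1) * (- 1) ^+ n
                    / ((1 + p) * (p - 2))))%:E].
Proof.
rewrite !(block_probE _ _ _ _ _ p X_indep X_true X_false).
have n_gt0 : (0 < n)%N := ltnW hn.
split; congr EFin.
- exact: prob_00.
- exact: (prob_zeros _ _ _ _ _ p X_indep X_true X_false n 0).
- exact: prob_010.
Qed.
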